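(* Let $d>3$ and let $k_0,\nu,\omega,\chi,b$ and the sets $\Sigma_1,\Sigma_2,\Sigma_{2,\chi},\mathcal Y_1,\mathcal Y_2$ be as in the context. Assume that $b\in C^1(\Sigma_{2,\chi};\mathbb C)$ and that $$\overline{\{\sigma\in\Sigma_2\mid \nabla b(\sigma)\notin\mathbb C\,\pi_\sigma\nu\}}=\Sigma_2,$$ where the closure is taken relative to $\Sigma_2$ (i.e. the set is dense in $\Sigma_2$). Then every continuous solution $g\in C(\mathbb R^d;\mathbb C)$ of the homogeneous system (HS) satisfies $g(y)=0$ for all $y\in\mathcal Y_1\cup\mathcal Y_2$.
   Context: Setting: $k_0>0$; $\nu,\omega\in\mathbb R^d$ are unit vectors; $\langle\cdot,\cdot\rangle$ is the Euclidean inner product; $\mathbb S^{d-1}_{k_0}=\{x\in\mathbb R^d\mid\|x\|=k_0\}$; $e_d$ is the $d$-th standard basis vector. For $v\in\mathbb R^d\setminus\{0\}$ put $S_v=\{s\in\mathbb S^{d-1}_{k_0}\mid\langle s,v\rangle>0\}$. $H_\nu x=x-2\langle x,\nu\rangle\nu$. $\Sigma_1=\{\sigma\in S_\omega\mid H_\nu\sigma\notin S_\omega\}$, $\Sigma_2=\{\sigma\in S_\omega\mid H_\nu\sigma\in S_\omega\}$. $\mathcal Y_j=\{\eta-\sigma\mid\eta\in S_{e_d},\ \sigma\in\Sigma_j\}$ for $j=1,2$. Fix $\chi\in(0,1)$ and let $\Sigma_{2,\chi}=\{\tilde\chi\sigma\mid\sigma\in\Sigma_2,\ \tilde\chi\in(1-\chi,1+\chi)\}\subseteq\mathbb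 R^d$ (an open set). $b:\Sigma_{2,\chi}\to\mathbb C\setminus\{0\}$ is a function with $b(\tilde\chi\sigma)=b(\sigma)$ for all $\sigma\in\Sigma_2$, $\tilde\chi\in(1-\chi,1+\chi)$. Homogeneous system (HS) for $g:\mathbb R^d\to\mathbb C$: for all $\eta\in S_{e_d}$, $g(\eta-\sigma)=0$ for every $\sigma\in\Sigma_1$, and $b(\sigma)g(\eta-\sigma)+g(\eta-H_\nu\sigma)=0$ for every $\sigma\in\Sigma_2$. For $\sigma\in\mathbb R^d\setminus\{0\}$, $\pi_\sigma x=x-\langle x,\sigma\rangle\sigma/\|\sigma\|^2$ is the orthogonal projection onto $\sigma^\perp$. $\nabla b(\sigma)\in\mathbb C^d$ is the gradient, and $\mathbb C\,\pi_\sigma\nu$ is the set of complex multiples of $\pi_\sigma\nu$. *)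

(* Defs.v *)
From HB Require Import structures.
From mathcomp Require Import all_boot all_order all_algebra.
From mathcomp Require Import complex.
From mathcomp Require Import all_classical all_reals all_analysis.

Set Implicit Arguments.
Unset Strict Implicit.
Unset Printing Implicit Defensive.

Import Order.TTheory GRing.Theory Num.Theory.
Import numFieldNormedType.Exports.

Local Open Scope classical_set_scope.
Local Open Scope ring_scope.
Local Open Scope complex_scope.

Section Geometry.
Context {R : realType} {d : nat}.
Implicit Types x y v nu omega : 'rV[R]_d.

Definition inner x y : R := \sum_(i < d) x ord0 i * y ord0 i.

(* Not the norm `|x| of 'rV[R]_d, which is the sup norm; both norms induce
   the same topology. *)
Definition enorm x : R := Num.sqrt (inner x x).

(* The last standard basis vector e_d (coordinates are numbered from 0). *)
Definition e_last : 'rV[R]_d := \row_(j < d) (j.+1 == d)%:R.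

Definition sphere (k0 : R) : set 'rV[R]_d := [set x | enorm x = k0].

Definition half_sphere (k0 : R) v : set 'rV[R]_d :=
  [set s | sphere k0 s /\ 0 < inner s v].

Definition reflection nu x : 'rV[R]_d := x - (2 * inner x nu) *: nu.

Definition Sigma1 (k0 : R) nu omega : set 'rV[R]_d :=
  [set s | half_sphere k0 omega s /\ ~ half_sphere k0 omega (reflection nu s)].

Definition Sigma2 (k0 : R) nu omega : set 'rV[R]_d :=
  [set s | half_sphere k0 omega s /\ half_sphere k0 omega (reflection nu s)].

Definition Sigma2chi (k0 : R) nu omega (chi : R) : set 'rV[R]_d :=
  [set t *: s | t in `]1 - chi, 1 + chi[%classic & s in Sigma2 k0 nu omega].

Definition Y1 (k0 : R) nu omega : set 'rV[R]_d :=
  [set eta - s | eta in half_sphere k0 e_last & s in Sigma1 k0 nu omega].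

Definition Y2 (k0 : R) nu omega : set 'rV[R]_d :=
  [set eta - s | eta in half_sphere k0 e_last & s in Sigma2 k0 nu omega].

Definition proj_perp (s x : 'rV[R]_d) : 'rV[R]_d :=
  x - (inner x s / enorm s ^+ 2) *: s.

Definition gradient (b : 'rV[R]_d -> R[i]) x : 'rV[R[i]]_d :=
  \row_(j < d) ('D_(delta_mx ord0 j) (@complex.Re R \o b) x
                +i* 'D_(delta_mx ord0 j) (@complex.Im R \o b) x).

(* b is of class C^1 on the open set U, as a function of real variables; as U
   is open, only the restriction of b to U matters.  The alias _^o equips R[i]
   with the topology of its modulus. *)
Definition C1_on (U : set 'rV[R]_d) (b : 'rV[R]_d -> R[i]) : Prop :=
  forall x, U x ->
    [/\ differentiable (@complex.Re R \o b) x,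
        differentiable (@complex.Im R \o b) x &
        {for x, continuous (gradient b : 'rV[R]_d -> 'rV[R[i]^o]_d)}].

Definition complex_multiples v : set 'rV[R[i]]_d :=
  [set c *: map_mx (real_complex R) v | c in [set: R[i]]].

Definition homogeneous_system (k0 : R) nu omega
    (b g : 'rV[R]_d -> R[i]) : Prop :=
  forall eta, half_sphere k0 e_last eta ->
    (forall s, Sigma1 k0 nu omega s -> g (eta - s) = 0) /\
    (forall s, Sigma2 k0 nu omega s ->
       b s * g (eta - s) + g (eta - reflection nu s) = 0).

End Geometry.

(* Main.v *)
(* If [y = eta - sigma], then [g (y + 2 <sigma', nu> nu) = - b sigma' * g y]
   for every other decomposition [y = eta' - sigma']. Hence, if [g y <> 0],
   [b] is constant along every curve through [sigma] on the sphere keeping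
   the inner products with [y] and [nu] fixed, and its derivative vanishes in
   the directions [tau] orthogonal to [sigma], [nu] and [eta]. Such a curve
   is [t |-> H_(tau + t a) sigma] with [a] orthogonal to [y] and [nu]. If the
   real or the imaginary part of the gradient [u] of [b] at [sigma] is not
   parallel to [pi_sigma nu], let [v <> 0] be its component orthogonal to
   [sigma] and [nu]; as [d > 3] there is [e <> 0] orthogonal to [sigma], [nu]
   and [u], and after moving [eta] slightly [<eta, e> <> 0]. Then [tau =
   <eta, e> v - <eta, v> e] is such a direction and [<tau, u> <> 0], a
   contradiction; density of these [sigma] and continuity of [g] conclude. *)

Require Import Defs.
From HB Require Import structures.
From mathcomp Require Import all_boot all_order all_algebra.
From mathcomp Require Import complex.
From mathcomp Require Import all_classical all_reals all_analysis.
From mathcomp Require Import ring lra.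

Set Implicit Arguments.
Unset Strict Implicit.
Unset Printing Implicit Defensive.

Import Order.TTheory GRing.Theory Num.Theory.
Import numFieldNormedType.Exports.

Local Open Scope classical_set_scope.
Local Open Scope ring_scope.
Local Open Scope complex_scope.

(** * The Euclidean inner product and orthogonal complements *)

Section InnerProduct.
Context {R : realType} {d : nat}.
Implicit Types x y z : 'rV[R]_d.

Lemma innerC x y : inner x y = inner y x.
Proof. by apply: eq_bigr => i _; rewrite mulrC. Qed.

Lemma innerDl x y z : inner (x + y) z = inner x z + inner y z.
Proof. by rewrite -big_split; apply: eq_bigr => i _; rewrite mxE mulrDl. Qed.

Lemma innerZl k x y : inner (k *: x) y = k * inner x y.
Proof. by rewrite mulr_sumr; apply: eq_bigr => i _; rewrite mxE mulrA. Qed.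

Lemma innerNl x y : inner (- x) y = - inner x y.
Proof. by rewrite -scaleN1r innerZl mulN1r. Qed.

Lemma innerDr x y z : inner x (y + z) = inner x y + inner x z.
Proof. by rewrite innerC innerDl !(innerC x). Qed.

Lemma innerZr k x y : inner x (k *: y) = k * inner x y.
Proof. by rewrite innerC innerZl (innerC x). Qed.

Lemma innerNr x y : inner x (- y) = - inner x y.
Proof. by rewrite innerC innerNl (innerC x). Qed.

Definition innerE := (innerDl, innerDr, innerNl, innerNr, innerZl, innerZr).

Lemma inner_mx x y : inner x y = (x *m y^T) ord0 ord0.
Proof. by rewrite mxE; apply: eq_bigr => i _; rewrite mxE. Qed.

Lemma inner_ge0 x : 0 <= inner x x.
Proof. by apply: sumr_ge0 => i _; rewrite -expr2 sqr_ge0. Qed.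

Lemma inner_eq0 x : (inner x x == 0) = (x == 0).
Proof.
apply/eqP/eqP => [x0|->]; last by rewrite -(scale0r 0) innerZl mul0r.
apply/rowP => i; apply/eqP; rewrite mxE -sqrf_eq0 expr2.
by rewrite (psumr_eq0P _ x0)// => j _; rewrite -expr2 sqr_ge0.
Qed.

Lemma enormP (k : R) x : 0 <= k -> enorm x = k <-> inner x x = k ^+ 2.
Proof.
move=> k0; split=> [<-|xk]; first by rewrite sqr_sqrtr// inner_ge0.
by rewrite /enorm xk sqrtr_sqr ger0_norm.
Qed.

Lemma inner_continuous y : continuous (inner^~ y : 'rV[R]_d -> R).
Proof.
move=> x; apply: (@cvg_big R _ +%R 0 _ _ _ (nbhs x)).
  exact: add_continuous.
by move=> i _; apply: cvgM; [exact: coord_continuous|exact: cvg_cst].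
Qed.

(** The matrix with columns [x], [y], [z] has rank at most 3, so its left kernel has dimension at
    least [d - 3 > 0]. *)
Lemma exists_inner3_eq0 x y z : (3 < d)%N ->
  exists e, [/\ e != 0, inner e x = 0, inner e y = 0 & inner e z = 0].
Proof.
move=> d3; pose A := row_mx (row_mx x^T y^T) z^T.
have : kermx A != 0.
  rewrite -mxrank_eq0 mxrank_ker -lt0n subn_gt0.
  exact: leq_ltn_trans (rank_leq_col _) d3.
move=> /rowV0Pn[e /sub_kermxP eA e0]; exists e.
move: eA; rewrite !mul_mx_row => /eqP.
rewrite !row_mx_eq0 => /andP[/andP[/eqP ex /eqP ey] /eqP ez].
by split=> //; rewrite inner_mx (ex, ey, ez) mxE.
Qed.

End InnerProduct.

(** * Reflections and the curves obtained by moving the normal *)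

Section Reflection.
Context {R : realType} {d : nat}.
Implicit Types n x y a tau : 'rV[R]_d.

(** Dividing by [inner n n] admits normals of any length, so that the normal can run along a line
    [tau + t *: a]. *)
Definition hrefl n x : 'rV[R]_d := x - (2 * inner x n / inner n n) *: n.

(* For [n = 0] this holds too, as [hrefl 0] is then the identity. *)
Lemma inner_hrefl n x y : inner (hrefl n x) (hrefl n y) = inner x y.
Proof.
have [->|] := eqVneq n 0; first by rewrite /hrefl !scaler0 !subr0.
by rewrite -inner_eq0 => n0; rewrite !innerE (innerC n y); field.
Qed.

Lemma hrefl_fix n x : inner x n = 0 -> hrefl n x = x.
Proof. by move=> xn; rewrite /hrefl xn mulr0 mul0r scale0r subr0. Qed.

Lemma hreflD n x y : hrefl n (x + y) = hrefl n x + hrefl n y.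
Proof. by rewrite /hrefl innerDl mulrDr mulrDl scalerDl opprD addrACA. Qed.

Lemma reflection_hrefl n x : enorm n = 1 -> reflection n x = hrefl n x.
Proof. by move=> /(enormP _ ler01) n1; rewrite /hrefl n1 expr1n divr1. Qed.

Lemma is_derive_scalel (V : normedModType R) (k : R -> R) (t dk : R) (v : V) :
  is_derive t 1 k dk -> is_derive t 1 (fun s => k s *: v) (dk *: v).
Proof.
move=> [/derivable1_diffP dfk <-]; have dkv := differentiableZl v dfk.
apply: DeriveDef; first exact/derivable1_diffP.
by rewrite !deriveE// diffZl.
Qed.

(** As [x] is orthogonal to [tau], the curve is [x - t * q t *: (tau + t *: a)] with
    [q t = 2 <x, a> / N t], so its velocity at 0 is [- q 0 *: tau]. *)
Lemma is_derive_hrefl x tau a : tau != 0 -> inner x tau = 0 ->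
  is_derive (0 : R) (1 : R) (fun t : R => hrefl (tau + t *: a) x : 'rV[R]_d)
    (- (2 * inner x a / inner tau tau) *: tau).
Proof.
rewrite -inner_eq0 => tau0 xtau.
pose N (t : R) := inner (tau + t *: a) (tau + t *: a).
pose q (t : R) := 2 * inner x a / N t.
have N0 : N 0 = inner tau tau by rewrite /N scale0r addr0.
have dq : derivable q 0 1.
  apply: derivableM; first exact: derivable_cst.
  apply: derivableV; first by rewrite N0.
  pose M : R -> R :=
    cst (inner tau tau) + ((2 * inner tau a) *: id + inner a a *: id ^+ 2).
  have -> : N = M.
    apply/funext => t; rewrite /N !innerE (innerC a tau).
    have -> : M t =
        inner tau tau + ((2 * inner tau a) * t + inner a a * t ^+ 2) by [].
    by ring.
  apply: derivableD; first exact: derivable_cst.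
  apply: derivableD; apply: derivableZ; first exact: derivable_id.
  by apply: derivableX; exact: derivable_id.
(* The factor [id] vanishes at 0, so the derivative of [q] drops out: [t * q t] has derivative [q 0]
   there, and [t * (t * q t)] has derivative 0. *)
have dK : is_derive (0 : R) 1 (id * q) (q 0).
  apply: is_derive_eq; first by apply: is_deriveM; exact/derivableP.
  by rewrite scale0r add0r [_ *: _]mulr1.
have dK2 : is_derive (0 : R) 1 (id * (id * q)) 0.
  have dM := is_deriveM (is_derive_id (0 : R) (1 : R)) dK.
  apply: (is_derive_eq dM).
  by rewrite scale0r add0r [(id * q) 0]mul0r scale0r.
have d1 := is_derive_scalel tau dK.
have d2 := is_derive_scalel a dK2.
have d3 := is_deriveB (is_derive_cst x (0 : R) (1 : R)) (is_deriveD d1 d2).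
have E : - (2 * inner x a / inner tau tau) *: tau = 0 - (q 0 *: tau + 0 *: a).
  by rewrite /q N0 scale0r addr0 sub0r scaleNr.
rewrite E; congr is_derive: d3; apply/funext => t.
have -> : (cst x - ((fun t => (id * q) t *: tau) +
      (fun t => (id * (id * q)) t *: a))) t =
      x - (t * q t *: tau + t * (t * q t) *: a) by [].
rewrite /hrefl -[inner (_ + _) (_ + _)]/(N t) innerDr innerZr xtau add0r.
rewrite scalerDr scalerA.
by rewrite /q; congr (_ - (_ *: _ + _ *: _)); ring.
Qed.

End Reflection.

(** * Real functions along differentiable curves *)

Section Curves.
Context {R : realType} {d : nat}.
Implicit Types (f : 'rV[R]_d -> R) (c : R -> 'rV[R]_d).

Definition rgrad f (x : 'rV[R]_d) : 'rV[R]_d :=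
  \row_(j < d) 'D_(delta_mx ord0 j) f x.

Lemma diff_rgrad f (x v : 'rV[R]_d) : differentiable f x ->
  'd f x v = inner (rgrad f x) v.
Proof.
move=> df; rewrite [in LHS](row_sum_delta v) linear_sum.
by apply: eq_bigr => j _; rewrite linearZ/= mxE deriveE// mulrC.
Qed.

Lemma is_derive_curve_continuous c (t : R) (v : 'rV[R]_d) :
  is_derive t (1 : R) c v -> {for t, continuous c}.
Proof. by move=> [/derivable1_diffP/differentiable_continuous]. Qed.

Lemma rgrad_curve_const f c (t : R) (v : 'rV[R]_d) :
  is_derive t (1 : R) c v -> differentiable f (c t) ->
  (\forall s \near t, f (c s) = f (c t)) -> inner (rgrad f (c t)) v = 0.
Proof.
move=> [/derivable1_diffP dc <-] df fc.
rewrite -diff_rgrad// deriveE//.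
have -> : 'd f (c t) ('d c t 1) = 'd (f \o c) t 1.
  by rewrite (diff_comp dc df).
rewrite -deriveE; last exact: differentiable_comp.
have fc' : \forall s \near t, (f \o c) s = cst (f (c t)) s by exact: fc.
by rewrite (near_eq_derive _ fc') derive_cst.
Qed.

Lemma near_curve_gt c (t r : R) (v : 'rV[R]_d) : {for t, continuous c} ->
  r < inner (c t) v -> \forall s \near t, r < inner (c s) v.
Proof.
move=> cc rt.
have : {for t, continuous (inner^~ v \o c)}.
  by apply: continuous_comp => //; exact: inner_continuous.
by move=> /(_ _ (lt_nbhsr rt)).
Qed.

End Curves.

(** * Directions on the sphere and constancy of the coefficient along curves *)

Section Geometry.
Context {R : realType} {d : nat}.
Implicit Types x y e nu omega sigma eta u v : 'rV[R]_d.

Lemma sphereP (k0 : R) x : 0 <= k0 -> sphere k0 x <-> inner x x = k0 ^+ 2.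
Proof. exact: enormP. Qed.

Lemma reflection_sphere (k0 : R) nu x : enorm nu = 1 ->
  sphere k0 x -> sphere k0 (reflection nu x).
Proof.
by move=> nu1; rewrite /sphere/= /enorm reflection_hrefl// inner_hrefl.
Qed.

Lemma hrefl_sphere (k0 : R) n x : sphere k0 x -> sphere k0 (hrefl n x).
Proof. by rewrite /sphere/= /enorm inner_hrefl. Qed.

(** Self-adjointness turns the condition that the reflected point lies in the half sphere of [omega]
    into a linear inequality on the point itself. *)
Lemma inner_reflection nu x y :
  inner (reflection nu x) y = inner x (reflection nu y).
Proof. by rewrite /reflection !innerE (innerC y nu); ring. Qed.

(* Otherwise the vector [sigma] of [Sigma2] is parallel to [nu], so that the
   reflection maps it to [- sigma]. *)
Lemma Sigma2_not_parallel (k0 : R) nu omega sigma : enorm nu = 1 -> 0 < k0 ->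
  Sigma2 k0 nu omega sigma -> k0 ^+ 2 - inner sigma nu ^+ 2 != 0.
Proof.
move=> nu1 k0gt0 [[sk sw] [_ rw]]; apply/negP => /eqP ksn.
have /(enormP _ ler01) := nu1; rewrite expr1n => nn.
have /(sphereP _ (ltW k0gt0)) ss := sk.
have : inner (sigma - inner sigma nu *: nu) (sigma - inner sigma nu *: nu) == 0.
  rewrite !innerE (innerC nu sigma) nn ss; apply/eqP.
  by rewrite -ksn; ring.
rewrite inner_eq0 subr_eq0 => /eqP snu.
suff E : reflection nu sigma = - sigma by move: rw; rewrite E innerNl; lra.
rewrite /reflection; move: (inner sigma nu) snu => k ->.
by apply/rowP => j; rewrite !mxE; ring.
Qed.

(* Both vectors are combinations of [e] with a vector orthogonal to [nu], the
   coefficients being chosen to achieve the third orthogonality. *)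
Lemma exists_directions eta sigma nu u v e :
  inner eta e != 0 -> inner sigma e = 0 -> inner nu e = 0 -> inner v e = 0 ->
  inner v sigma = 0 -> inner v nu = 0 -> inner v u != 0 -> inner u e = 0 ->
  inner nu nu = 1 -> inner sigma sigma - inner sigma nu ^+ 2 != 0 ->
  exists tau a, [/\ inner tau u != 0, inner tau sigma = 0, inner tau nu = 0 &
    inner tau (eta - sigma) = 0] /\
    [/\ inner a sigma != 0, inner a nu = 0 & inner a (eta - sigma) = 0].
Proof.
move=> ee se ne ve vs vn vu ue nn ssn.
pose s := sigma - inner sigma nu *: nu.
exists (inner eta e *: v - inner eta v *: e).
exists (inner eta e *: s - inner (eta - sigma) s *: e).
rewrite /s !innerE !(innerC e) vs vn (innerC nu sigma) nn se ne ue.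
rewrite (innerC v eta) (innerC nu eta) (innerC sigma eta).
split; split; try by ring.
(* The two nonzero products are [<eta, e> <v, u>] and [<eta, e> (<sigma, sigma> - <sigma,
   nu>^2)]. *)
- by rewrite mulr0 oppr0 addr0 mulf_neq0.
- by rewrite mulr0 oppr0 addr0 mulf_neq0// -expr2.
Qed.

(** Euler's relation in degree 0, read off the ray [t *: x], whose velocity at 1 is [x]. *)
Lemma rgrad_homogeneous (f : 'rV[R]_d -> R) x : differentiable f x ->
  (\forall t \near (1 : R), f (t *: x) = f x) -> inner (rgrad f x) x = 0.
Proof.
move=> df fx.
have dc := is_derive_scalel x (is_derive_id (1 : R) (1 : R)).
by have := rgrad_curve_const dc; rewrite /= !scale1r; exact.
Qed.

(* [v] is the component of [u] orthogonal to [x] and [nu]. *)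
Lemma exists_orthogonal_component (k : R) u x nu :
  inner x x = k ^+ 2 -> k != 0 -> inner nu nu = 1 ->
  k ^+ 2 - inner x nu ^+ 2 != 0 -> inner u x = 0 ->
  (forall r : R, u <> r *: proj_perp x nu) ->
  exists v, [/\ inner v x = 0, inner v nu = 0, inner v u != 0 &
    forall e, inner x e = 0 -> inner nu e = 0 -> inner u e = 0 ->
      inner v e = 0].
Proof.
move=> xx k0 nn xn ux unp.
have ek : enorm x ^+ 2 = k ^+ 2 by rewrite sqr_sqrtr ?inner_ge0.
have pE : proj_perp x nu = nu - (inner nu x / k ^+ 2) *: x.
  by rewrite /proj_perp ek.
move: (proj_perp x nu) pE unp => p pE unp.
have px : inner p x = 0 by rewrite pE !innerE xx; field.
have pn : inner p nu = (k ^+ 2 - inner x nu ^+ 2) / k ^+ 2.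
  by rewrite pE !innerE nn (innerC nu x); field.
have pp : inner p p = inner p nu by rewrite {2}pE !innerE px; ring.
have pp0 : inner p p != 0 by rewrite pp pn mulf_neq0 ?invr_eq0 ?expf_neq0.
have [v vE] : exists v, v = u - (inner u p / inner p p) *: p by eexists.
have vx : inner v x = 0 by rewrite vE !innerE ux px; ring.
have vp : inner v p = 0 by rewrite vE !innerE; field.
(* The vectors [p] and [x] span [nu], so orthogonality to both suffices. *)
have vn : inner v nu = 0.
  have -> : nu = p + (inner nu x / k ^+ 2) *: x by rewrite pE subrK.
  by rewrite innerDr innerZr vx vp; ring.
exists v; split=> //.
(* The difference [u - v] is a multiple of [p], hence orthogonal to [v]; and [v] is nonzero because
   [u] is no multiple of [p]. *)
- have -> : inner v u = inner v v by rewrite {3}vE !innerE vp; ring.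
  by rewrite inner_eq0 vE subr_eq0; apply/eqP; exact: unp.
- move=> e xe ne ue; have pe : inner p e = 0 by rewrite pE !innerE xe ne; ring.
  by rewrite vE !innerE ue pe; ring.
Qed.

(** Replacing [sigma] by a point of the curve and [eta] by its image under the same reflection
    changes neither argument of [g] in the system; the common nonzero factor [g (eta - sigma)] then
    cancels. *)
Lemma HS_coeff_const_near (k0 : R) nu omega (b g : 'rV[R]_d -> R[i])
    eta sigma tau a :
  0 <= k0 -> enorm nu = 1 -> homogeneous_system k0 nu omega b g ->
  half_sphere k0 e_last eta -> Sigma2 k0 nu omega sigma ->
  tau != 0 -> inner tau sigma = 0 -> inner tau nu = 0 ->
  inner tau (eta - sigma) = 0 -> inner a nu = 0 -> inner a (eta - sigma) = 0 ->
  g (eta - sigma) != 0 ->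
  \forall t \near (0 : R), b (hrefl (tau + t *: a) sigma) = b sigma.
Proof.
move=> k0ge0 nu1 hs he hsg tau0 ts tn ty an ay gy.
have dc := is_derive_hrefl a tau0 (etrans (innerC _ _) ts).
pose c (t : R) := hrefl (tau + t *: a) sigma.
have cc : {for 0, continuous c} := is_derive_curve_continuous dc.
have c0 : c 0 = sigma by rewrite /c scale0r addr0 hrefl_fix// innerC.
have [[sk sw] [_ rw]] := hsg; have [ek ee] := he.
(* The moving normal is orthogonal to [nu], so [<c t, nu>] stays equal to [<sigma, nu>]. *)
have nr t : reflection nu (c t) = c t - (2 * inner sigma nu) *: nu.
  have n0 : inner nu (tau + t *: a) = 0.
    by rewrite innerC innerDl innerZl tn an mulr0 addr0.
  by rewrite /reflection -[X in inner _ X](hrefl_fix n0) inner_hrefl.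
(* The reflection fixes [eta - sigma]; hence this sum stays on the sphere. *)
have yc t : eta - sigma + c t = hrefl (tau + t *: a) eta.
  have y0 : inner (eta - sigma) (tau + t *: a) = 0.
    by rewrite innerC innerDl innerZl ty ay mulr0 addr0.
  by rewrite -{1}(hrefl_fix y0) -hreflD subrK.
have ec : - inner (eta - sigma) e_last < inner sigma e_last.
  by rewrite innerDl innerNl; move: ee; lra.
(* The half-sphere conditions on [c t], its reflection and [eta - sigma + c t] are strict
   inequalities valid at 0, so they persist nearby. *)
have n1 : \forall t \near (0 : R), 0 < inner (c t) omega.
  by apply: near_curve_gt cc _; rewrite c0.
have n2 : \forall t \near (0 : R), 0 < inner (c t) (reflection nu omega).
  by apply: near_curve_gt cc _; rewrite c0 -inner_reflection.
have n3 : \forall t \near (0 : R),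
    - inner (eta - sigma) e_last < inner (c t) e_last.
  by apply: near_curve_gt cc _; rewrite c0.
have bc t : 0 < inner (c t) omega -> 0 < inner (reflection nu (c t)) omega ->
    - inner (eta - sigma) e_last < inner (c t) e_last ->
    b (c t) * g (eta - sigma) = - g (eta - sigma + (2 * inner sigma nu) *: nu).
  move=> cw rcw ce.
  have h1 : half_sphere k0 e_last (eta - sigma + c t).
    by split; [rewrite yc; exact: hrefl_sphere|rewrite innerDl; lra].
  have h2 : Sigma2 k0 nu omega (c t).
    have ck : sphere k0 (c t) by exact: hrefl_sphere.
    by split; split=> //; exact: reflection_sphere.
  have [_ /(_ _ h2)] := hs _ h1.
  rewrite nr addrK opprB addrACA subrr addr0.
  by move/eqP; rewrite addr_eq0 => /eqP.
have b0 := bc 0; rewrite c0 in b0.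
apply: filterS3 n1 n2 n3 => t t1 t2 t3.
by apply: (mulIf gy); rewrite b0// bc// inner_reflection.
Qed.

End Geometry.

(** * Vanishing of the solution where the gradient is not parallel, and on the closure *)

Section Vanishing.
Context {R : realType} {d : nat}.
Implicit Types x y e nu omega sigma eta u v : 'rV[R]_d.

Lemma continuous_neq0_near (T : topologicalType) (F : T -> R[i]) (x : T) :
  {for x, continuous (F : T -> R[i]^o)} -> F x != 0 ->
  \forall y \near x, F y != 0.
Proof. by move=> cF Fx; exact: (cvgr_neq0 (F x : R[i]^o) cF Fx). Qed.

(** If [eta] is orthogonal to [e], it is moved along the curve of its reflections with normals
    [e + t *: eta], which leaves the orthogonal complement of [e] at once. *)
Lemma HS_perturb (k0 : R) (g : 'rV[R]_d -> R[i]) eta sigma e :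
  0 < k0 -> e != 0 -> continuous (g : 'rV[R]_d -> R[i]^o) ->
  half_sphere k0 e_last eta -> g (eta - sigma) != 0 ->
  exists eta', [/\ half_sphere k0 e_last eta', inner eta' e != 0 &
    g (eta' - sigma) != 0].
Proof.
move=> k0gt0 e0 gc [ek ee] gy.
have [ete|ete] := eqVneq (inner eta e) 0; last by exists eta.
have dc := is_derive_hrefl eta e0 ete.
pose c (t : R) := hrefl (e + t *: eta) eta.
have cc : {for 0, continuous c} := is_derive_curve_continuous dc.
have c0 : c 0 = eta by rewrite /c scale0r addr0 hrefl_fix.
have n1 : \forall t \near (0 : R), 0 < inner (c t) e_last.
  by apply: near_curve_gt cc _; rewrite c0.
have n2 : \forall t \near (0 : R), g (c t - sigma) != 0.
  apply: continuous_neq0_near; last by rewrite c0.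
  apply: (@continuous_comp _ _ _ (fun t => c t - sigma) (g : _ -> R[i]^o)).
    by apply: continuousB => //; exact: cst_continuous.
  exact: gc.
(* A strictly positive [t] is required, since [<c t, e> = - 2 t k0^2 <e, e> / (<e, e> + t^2 k0^2)]
   vanishes at 0. *)
have [t [t0 ct gt]] : exists t : R,
    [/\ 0 < t, 0 < inner (c t) e_last & g (c t - sigma) != 0].
  have : \forall t \near 0^'+,
      [/\ (0 : R) < t, 0 < inner (c t) e_last & g (c t - sigma) != 0].
    near=> t; split; [by []|near: t|near: t].
      exact: cvg_within n1.
    exact: cvg_within n2.
  exact: filter_ex.
exists (c t); split => //; first by split=> //; exact: hrefl_sphere.
have /(sphereP _ (ltW k0gt0)) kk := ek.
have ei : 0 < inner e e by rewrite lt_def inner_eq0 e0 inner_ge0.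
have N0 : 0 < inner e e + t ^+ 2 * k0 ^+ 2.
  by rewrite ltr_wpDr// mulr_ge0 ?sqr_ge0.
have NE : inner (e + t *: eta) (e + t *: eta) = inner e e + t ^+ 2 * k0 ^+ 2.
  by rewrite !innerE (innerC e) ete kk; ring.
rewrite /c /hrefl NE !innerE ete kk mulr0 addr0 !add0r oppr_eq0.
by rewrite !mulf_neq0 ?invr_eq0 ?gt_eqF.
Unshelve. all: by end_near. Qed.

(** The function [f] stands for the real or the imaginary part of [b]; all that matters is that it
    is constant wherever [b] is. *)
Lemma HS_vanish (k0 : R) nu omega (b g : 'rV[R]_d -> R[i]) (f : 'rV[R]_d -> R)
    eta sigma :
  (3 < d)%N -> 0 < k0 -> enorm nu = 1 ->
  continuous (g : 'rV[R]_d -> R[i]^o) ->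
  homogeneous_system k0 nu omega b g ->
  half_sphere k0 e_last eta -> Sigma2 k0 nu omega sigma ->
  (forall x y, b x = b y -> f x = f y) -> differentiable f sigma ->
  (\forall t \near (1 : R), b (t *: sigma) = b sigma) ->
  (forall r : R, rgrad f sigma <> r *: proj_perp sigma nu) ->
  g (eta - sigma) = 0.
Proof.
move=> d3 k0gt0 nu1 gc hs he hsg bf df bhom unp.
apply/eqP; apply: contrapT => /negP gy.
have nn : inner nu nu = 1 by have /(enormP _ ler01) := nu1; rewrite expr1n.
have ss : inner sigma sigma = k0 ^+ 2.
  by case: hsg => -[/(sphereP _ (ltW k0gt0))].
have sn := Sigma2_not_parallel nu1 k0gt0 hsg.
have us : inner (rgrad f sigma) sigma = 0.
  by apply: rgrad_homogeneous => //; near do apply: bf.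
have [v [vs vn vu ve]] :=
  exists_orthogonal_component ss (lt0r_neq0 k0gt0) nn sn us unp.
have [e [e0 es en eu]] := exists_inner3_eq0 sigma nu (rgrad f sigma) d3.
have [eta' [he' ee' gy']] := HS_perturb k0gt0 e0 gc he gy.
rewrite innerC in es; rewrite innerC in en; rewrite innerC in eu.
rewrite -ss in sn.
have [tau [a [[tu ts tn ty] [as_ an ay]]]] :=
  exists_directions ee' es en (ve _ es en eu) vs vn vu eu nn sn.
have tau0 : tau != 0.
  by apply: contraNneq tu => ->; rewrite -(scale0r 0) innerZl mul0r.
have bc := HS_coeff_const_near (ltW k0gt0) nu1 hs he' hsg tau0
  ts tn ty an ay gy'.
have dc := is_derive_hrefl a tau0 (etrans (innerC _ _) ts).
have c0 : hrefl (tau + 0 *: a) sigma = sigma.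
  by rewrite scale0r addr0 hrefl_fix// innerC.
have := rgrad_curve_const dc; rewrite /= c0 => /(_ f df).
have fc : \forall t \near (0 : R), f (hrefl (tau + t *: a) sigma) = f sigma.
  by near do apply: bf.
(* The velocity is a nonzero multiple of [tau] because [<sigma, a> <> 0], so the vanishing
   derivative contradicts [<tau, u> <> 0] for the gradient [u] of [f]. *)
move=> /(_ fc)/eqP; rewrite innerZr mulf_eq0 oppr_eq0 !mulf_eq0 invr_eq0.
rewrite inner_eq0 pnatr_eq0 (negPf tau0) (innerC sigma) (negPf as_).
by rewrite innerC (negPf tu).
Unshelve. all: by end_near. Qed.

(** A nonzero value at [x] would persist on a neighbourhood, which meets [D]. *)
Lemma closure_eq0 (T : topologicalType) (D : set T) (F : T -> R[i]) (x : T) :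
  {for x, continuous (F : T -> R[i]^o)} -> closure D x ->
  (forall z, D z -> F z = 0) -> F x = 0.
Proof.
move=> cF Dx F0; apply/eqP; apply: contrapT => /negP Fx.
have [z [/F0 Fz /=]] := Dx _ (continuous_neq0_near cF Fx).
by rewrite Fz eqxx.
Qed.

End Vanishing.

Theorem theorem4p5 (R : realType) (d : nat) (k0 chi : R)
    (nu omega : 'rV[R]_d) (b : 'rV[R]_d -> R[i])
    (hd : (3 < d)%N) (hk0 : 0 < k0)
    (hnu : enorm nu = 1) (homega : enorm omega = 1)
    (hchi0 : 0 < chi) (hchi1 : chi < 1)
    (hb_neq0 : forall x, Sigma2chi k0 nu omega chi x -> b x <> 0)
    (hb_homog : forall (s : 'rV[R]_d) (t : R), Sigma2 k0 nu omega s ->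
       1 - chi < t < 1 + chi -> b (t *: s) = b s)
    (hb_C1 : C1_on (Sigma2chi k0 nu omega chi) b)
    (hb_dense :
       closure [set s | Sigma2 k0 nu omega s /\
                        ~ complex_multiples (proj_perp s nu) (gradient b s)]
         `&` Sigma2 k0 nu omega = Sigma2 k0 nu omega) :
  forall g : 'rV[R]_d -> R[i],
    continuous (g : 'rV[R]_d -> R[i]^o) ->
    homogeneous_system k0 nu omega b g ->
    forall y, (Y1 k0 nu omega `|` Y2 k0 nu omega) y -> g y = 0.
Proof.
move=> g gc hs y [[eta he [s hs1 <-]]|[eta he [s hs2 <-]]].
  by have [+ _] := hs _ he; exact.
(* With [eta] fixed, density and continuity of [g] reduce the claim to those [s] where the gradient
   condition holds. *)
move: (hs2); rewrite -[X in X s]hb_dense => -[cls _].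
have cF : {for s, continuous ((fun x => g (eta - x)) : 'rV[R]_d -> R[i]^o)}.
  have cB : {for s, continuous (fun x : 'rV[R]_d => eta - x)}.
    by apply: continuousB => //; exact: cst_continuous.
  exact: continuous_comp cB (gc (eta - s)).
apply: (closure_eq0 cF cls).
move=> {s hs2 cls cF}s [hs2 hgrad].
have sU : Sigma2chi k0 nu omega chi s.
  exists 1; first by rewrite /= in_itv/=; lra.
  by exists s => //; rewrite scale1r.
have [dRe dIm _] := hb_C1 s sU.
have bhom : \forall t \near (1 : R), b (t *: s) = b s.
  near=> t; apply: hb_homog => //; apply/andP; split; near: t.
    by apply: lt_nbhsr; lra.
  by apply: lt_nbhsl; lra.
have [[r rE]|nRe] := pselect (exists r,
    rgrad (@complex.Re R \o b) s = r *: proj_perp s nu); last first.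
  apply: (HS_vanish hd hk0 hnu gc hs he hs2 _ dRe bhom); last first.
    by move=> r rE; apply: nRe; exists r.
  by move=> x z /= ->.
have [[q qE]|nIm] := pselect (exists r,
    rgrad (@complex.Im R \o b) s = r *: proj_perp s nu); last first.
  apply: (HS_vanish hd hk0 hnu gc hs he hs2 _ dIm bhom); last first.
    by move=> q qE; apply: nIm; exists q.
  by move=> x z /= ->.
(* If both real gradients are multiples of [proj_perp s nu], their factors [r] and [q] combine into
   one complex factor, which is excluded. *)
exfalso; apply: hgrad; exists (r +i* q) => //; apply/rowP => j.
move/rowP/(_ j): rE; move/rowP/(_ j): qE.
rewrite !mxE => -> ->.
by rewrite /= /GRing.mul/= !mulr0 subr0 add0r.
Unshelve. all: by end_near. Qed.
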